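(* Let $\Delta = (Q,\Gamma,\delta)$ be a probabilistic pushdown automaton (pPDA) with fundamental PPS $f$. Suppose that $\Delta$ is cPAST with maximal conditional expected runtime $C$ and minimal non-zero return probability $m$. Then for every $\varepsilon > 0$ there exists $u \in \mathbb{Q}_{\ge 0}^{Q\times\Gamma\times Q}$ with $f(u)\le u$ (component-wise) and $\|\mu f - u\|_\infty \le \varepsilon$, such that the rational numbers in $u$ can be encoded as pairs of integers with bit-complexity at most $$\mathcal{O}\Big(\log C + \log\tfrac{1}{m} + \log|Q| + \log|\Gamma| + \log\tfrac{1}{\varepsilon}\Big).$$
   Context: A pPDA $\Delta=(Q,\Gamma,\delta)$ has a finite state set $Q$, a finite stack alphabet $\Gamma$, and a weighted transition relation $\delta \subseteq Q\times\Gamma\times\mathbb{Q}_{\ge 0}\times Q\times\Gamma^{\le 2}$ ($\Gamma^{\le 2}$: words of length at most 2), where for each $(p,Z,q,\alpha)$ there is at most one $a$ with $(p,Z,a,q,\alpha)\in\delta$; such a transition is written $pZ \xrightarrow{a} q\alpha$. For all $pZ\in Q\times\Gamma$ one requires $\sum_{pZ\xrightarrow{a}q\alpha} a = 1$. Configurations are elements $p\gamma$ of $Q\times\Gamma^*$; each transition $pZ\xrightarrow{a}q\alpha$ and $\beta\in\Gamma^*$ yields a step $pZ\beta \to q\alpha\beta$ of probability $a$; configurations with empty stack (written $p\epsilon$, with $\epsilon$ the empty word) have no outgoing steps. The probability of a finite path of configurations is the product of its step probabilities; its length is its number of steps. For $p,q\in Q$, $Z\in\Gamma$: the return probability $[pZ|q]$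 is the sum of the probabilities of all finite paths from $pZ$ to $q\epsilon$, and the 1st termination moment $\mathsf{E}[pZ|q]\in[0,\infty]$ is the sum, over all these paths, of probability times length. $\Delta$ is cPAST if $\mathsf{E}[pZ|q]/[pZ|q] < \infty$ whenever $[pZ|q]>0$. The maximal conditional expected runtime is $C=\max \mathsf{E}[pZ|q]/[pZ|q]$ and the minimal non-zero return probability is $m=\min [pZ|q]$, both over all $(p,Z,q)$ with $[pZ|q]>0$. The fundamental PPS (positive polynomial system) $f$ of $\Delta$ is the polynomial map indexed by $Q\times\Gamma\times Q$ given by $$f_{pZq}(x)=\sum_{pZ\xrightarrow{a}q\epsilon}a+\sum_{pZ\xrightarrow{a}rY}a\,x_{rYq}+\sum_{pZ\xrightarrow{a}rYX}a\sum_{t\in Q}x_{rYt}\,x_{tXq}.$$ As a monotone map on $[0,\infty]^{Q\times\Gamma\times Q}$ it has a least fixed point $\mu f$, and it is known that $(\mu f)_{pZq}=[pZ|q]$. *)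

(* Defs.v *)
(* MathComp / MathComp-Analysis. *)
From HB Require Import structures.
From mathcomp Require Import all_boot all_order all_algebra.
From mathcomp Require Import all_classical all_reals all_analysis.

Set Implicit Arguments.
Unset Strict Implicit.
Unset Printing Implicit Defensive.

Import Order.TTheory GRing.Theory Num.Theory.

Local Open Scope classical_set_scope.
Local Open Scope ring_scope.

(* [delta p Z q alpha = Some a] stands for the transition pZ -a-> q alpha; a
   relation with at most one weight a per (p, Z, q, alpha) is a partial
   function.  [Some 0], a transition of weight zero, is allowed. *)
Record ppda (Q G : finType) := PPDA {
  delta : Q -> G -> Q -> 2.-bseq G -> option rat;
  delta_ge0 : forall p Z q alpha a, delta p Z q alpha = Some a -> 0 <= a;
  delta_sum1 : forall p Z,
    \sum_(q : Q) \sum_(alpha : 2.-bseq G) odflt 0 (delta p Z q alpha) = 1 }.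

Section ppda_theory.
Variables (R : realType) (Q G : finType) (D : ppda Q G).

Definition weight (p : Q) (Z : G) (q : Q) (alpha : 2.-bseq G) : rat :=
  odflt 0 (delta D p Z q alpha).

Local Notation config := (Q * seq G)%type.

Definition step (c d : config) : bool :=
  if c.2 is Z :: beta then
    [exists alpha : 2.-bseq G,
       (delta D c.1 Z d.1 alpha != None) && (d.2 == alpha ++ beta)]
  else false.

(* At most one [alpha] satisfies the filter, so the sum is the weight of the
   transition that yields the step (and 0 if [c], [d] is not a step). *)
Definition step_prob (c d : config) : rat :=
  if c.2 is Z :: beta then
    \sum_(alpha : 2.-bseq G | d.2 == alpha ++ beta) weight c.1 Z d.1 alpha
  else 0.

(* The path c, s_0, s_1, ... is represented by its start [c] and the sequence
   [s] of the remaining configurations, so its length is [size s]. *)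
Fixpoint path_prob (c : config) (s : seq config) : rat :=
  if s is d :: s' then step_prob c d * path_prob d s' else 1.

Definition term_paths (p : Q) (Z : G) (q : Q) : set (seq config) :=
  [set s | path step (p, [:: Z]) s /\ last (p, [:: Z]) s = (q, [::])].

(* An index (p, Z, q) of Q * G * Q is written i = (i.1.1, i.1.2, i.2). *)
Definition ret_prob (i : Q * G * Q) : \bar R :=
  \esum_(s in term_paths i.1.1 i.1.2 i.2)
    (ratr (path_prob (i.1.1, [:: i.1.2]) s))%:E.

Definition term_moment (i : Q * G * Q) : \bar R :=
  \esum_(s in term_paths i.1.1 i.1.2 i.2)
    (ratr (path_prob (i.1.1, [:: i.1.2]) s) * (size s)%:R)%:E.

Definition cPAST : Prop :=
  forall i, (0 < ret_prob i -> term_moment i / ret_prob i < +oo)%E.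

(* The values 0 and +oo are the neutral elements of max and min on [0, +oo];
   they are returned only if all return probabilities are zero.  [fine] sends
   both to 0, and then [ln C] and [ln m^-1] are 0 since [ln 0 = 0]. *)
Definition max_cond_runtime : \bar R :=
  (\big[maxe/0]_(i | (0 < ret_prob i)%E) (term_moment i / ret_prob i))%E.

Definition min_ret_prob : \bar R :=
  (\big[mine/+oo]_(i | (0 < ret_prob i)%E) ret_prob i)%E.

Definition fpps (x : Q * G * Q -> \bar R) (i : Q * G * Q) : \bar R :=
  let: (p, Z, q) := i in
  ((ratr (weight p Z q (Bseq (isT : (size ([::] : seq G) <= 2)%N))))%:E
   + \sum_(r : Q) \sum_(Y : G)
       (ratr (weight p Z r (Bseq (isT : (size [:: Y] <= 2)%N))))%:E
       * x (r, Y, q)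
   + \sum_(r : Q) \sum_(Y : G) \sum_(X : G)
       (ratr (weight p Z r (Bseq (isT : (size [:: Y; X] <= 2)%N))))%:E
       * \sum_(t : Q) x (r, Y, t) * x (t, X, q))%E.

End ppda_theory.

Section least_fixed_point.
Variables (R : realType) (I : Type).
Implicit Types (F : (I -> \bar R) -> I -> \bar R) (x : I -> \bar R).

Definition is_lfp F x : Prop :=
  [/\ forall i, (0 <= x i)%E, forall i, F x i = x i
    & forall y, (forall i, (0 <= y i)%E) -> (forall i, F y i = y i) ->
      forall i, (x i <= y i)%E].

Definition lfp F : I -> \bar R := xget (fun=> 0%E) [set x | is_lfp F x].

(* Knaster-Tarski on [0, +oo]^I: the default of [xget] is not used. *)
Lemma lfpP F :
  (forall x, (forall i, 0 <= x i)%E -> forall i, (0 <= F x i)%E) ->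
  (forall x y, (forall i, 0 <= x i)%E -> (forall i, x i <= y i)%E ->
     forall i, (F x i <= F y i)%E) ->
  is_lfp F (lfp F).
Proof.
move=> F0 Fmono; rewrite /lfp; apply: (@xgetPex _ _ [set x | is_lfp F x]).
pose P := [set y : I -> \bar R |
  (forall i, 0 <= y i)%E /\ (forall i, F y i <= y i)%E].
pose x i := ereal_inf [set y i | y in P].
have x0 i : (0 <= x i)%E by apply: le_ereal_inf_tmp => _ [y [y0 _] <-].
have xle y i : P y -> (x i <= y i)%E by move=> Py; apply: ereal_inf_lbound; exists y.
have Fx i : (F x i <= x i)%E.
  apply: le_ereal_inf_tmp => _ [y Py <-]; apply: le_trans (Py.2 i).
  by apply: Fmono => // j; exact: xle.
exists x; split=> // [i|y y0 Fy i].
- apply/eqP; rewrite eq_le Fx /=; apply: xle; split=> [|j]; first exact: F0.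
  by apply: Fmono => //; exact: F0.
- by apply: xle; split=> // j; rewrite Fy.
Qed.

End least_fixed_point.

Lemma fpps_lfp (R : realType) (Q G : finType) (D : ppda Q G) :
  is_lfp (@fpps R Q G D) (lfp (@fpps R Q G D)).
Proof.
have w0 p Z q alpha : (0 <= (ratr (weight D p Z q alpha))%:E :> \bar R)%E.
  rewrite lee_fin ler0q /weight.
  by case E : (delta D p Z q alpha) => [a|] //=; exact: delta_ge0 E.
apply: lfpP => [x x0 [[p Z] q]|x y x0 xy [[p Z] q]] /=.
- rewrite !adde_ge0//; first by do 2![apply: sume_ge0 => ? _]; rewrite mule_ge0.
  do 3![apply: sume_ge0 => ? _]; rewrite mule_ge0// sume_ge0// => t _.
  by rewrite mule_ge0.
- rewrite !leeD//.
    by do 2![apply: lee_sum => ? _]; exact: lee_wpmul2l.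
  do 3![apply: lee_sum => ? _]; apply: lee_wpmul2l => //.
  by apply: lee_sum => t _; exact: lee_pmul.
Qed.

Definition norm_inf (R : realType) (I : finType) (x : I -> \bar R) : \bar R :=
  (\big[maxe/0]_i `|x i|)%E.

(* Binary digits of |z| (one digit for z = 0) and a sign bit. *)
Definition bitsize (z : int) : nat := ((trunc_log 2 `|z|).+1 + 1)%N.

Definition encodable_in (R : realType) (B : R) (v : rat) : Prop :=
  exists a b : int,
    [/\ b != 0, v = a%:~R / b%:~R & (bitsize a + bitsize b)%:R <= B].

(* Main.v *)
(* Write r for the vector of return probabilities, E for that of the first
   termination moments and f(x) = c + l(x) + b(x, x) with l linear and b bilinear.
   Splitting off the first step of a path gives f(r) = r and r + f'(r)E <= E
   (in fact an equality).  As E <= C r, also b(E, E) <= C^2 b(r, r) <= C^2 r, so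
   for small d the point r + d E satisfies
     f(r + d E) <= r + d (E - r) + d^2 C^2 r <= (r + d E) - (d / 2) r
   as soon as d C^2 <= 1 / 2.  The slack (d / 2) r is at least d m / 2 on the
   support of r, which leaves room for rounding r + d E up to a multiple of
   2^-k with 2^-k of order d m; off the support both r and E vanish and nothing
   has to be rounded.  Taking d of order min(1, eps) / C^2 keeps the point within
   eps of r and makes k logarithmic in C, 1/m and 1/eps. *)
Require Import Defs.
From mathcomp Require Import all_boot all_order all_algebra.
From mathcomp Require Import all_classical all_reals all_analysis.
From mathcomp Require Import ring lra zify.

Set Implicit Arguments.
Unset Strict Implicit.
Unset Printing Implicit Defensive.

Import Order.TTheory GRing.Theory Num.Theory.
Local Open Scope ring_scope.

(** * Words of length at most two *)

Lemma catIs (T : eqType) (beta : seq T) : injective (cat^~ beta).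
Proof.
move=> s s' /= e; apply/eqP; move: (e) => /eqP; rewrite eqseq_cat ?eqxx ?andbT//.
by move: (congr1 size e); rewrite !size_cat => /addIn.
Qed.


(** Words of length at most two correspond to [unit + (G + G * G)]. This turns a sum over all
    transitions into the pop, replace and push sums of [fpps]. *)
Lemma sum_2bseq (V : nmodType) (G : finType) (F : 2.-bseq G -> V) :
  \sum_(al : 2.-bseq G) F al =
  F (Bseq (isT : (size ([::] : seq G) <= 2)%N))
  + \sum_(Y : G) F (Bseq (isT : (size [:: Y] <= 2)%N))
  + \sum_(Y : G) \sum_(X : G) F (Bseq (isT : (size [:: Y; X] <= 2)%N)).
Proof.
pose T := (unit + (G + G * G))%type.
pose h (t : T) : 2.-bseq G := match t with
  | inl _ => Bseq (isT : (size ([::] : seq G) <= 2)%N)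
  | inr (inl Y) => Bseq (isT : (size [:: Y] <= 2)%N)
  | inr (inr YX) => Bseq (isT : (size [:: YX.1; YX.2] <= 2)%N) end.
pose g (al : 2.-bseq G) : T := match bseqval al with
  | [::] => inl tt | [:: Y] => inr (inl Y) | [:: Y, X & _] => inr (inr (Y, X)) end.
have hK : cancel h g by move=> [[]|[Y|[Y X]]].
have gK : cancel g h.
  by case=> -[|Y [|X [|W s]]] ps; apply: val_inj.
rewrite (reindex h) /=; last by exists g => // ? _.
rewrite !big_sumType /= pair_bigA -addrA; congr (_ + (_ + _)).
by rewrite (big_pred1 tt) //; case.
Qed.

(** * Cauchy products of nonnegative sequences *)

Section convolution.
Variable R : realDomainType.
Implicit Types a b : nat -> R.

Definition cauchy_prod a b n : R := \sum_(k < n.+1) a k * b (n - k)%N.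

Lemma sum_cauchy_prod a b N :
  \sum_(n < N) cauchy_prod a b n = \sum_(k < N) a k * \sum_(j < N - k) b j.
Proof.
elim: N => [|N IH]; first by rewrite !big_ord0.
rewrite big_ord_recr /= IH /cauchy_prod !big_ord_recr /= addrA -big_split /=.
rewrite subnn subSnn !big_ord1; congr (_ + _); apply: eq_bigr => k _.
by rewrite -mulrDr subSn ?(ltnW (ltn_ord k))// big_ord_recr.
Qed.

Lemma ler_sum_ord a M N : (forall n, 0 <= a n) -> (M <= N)%N ->
  \sum_(n < M) a n <= \sum_(n < N) a n.
Proof.
move=> a0 MN; rewrite (big_ord_widen _ _ MN) big_mkcond /=.
by apply: ler_sum => i _; case: ifP.
Qed.

(** The triangle k + j < N lies in the square k, j < N. *)
Lemma sum_cauchy_prod_le a b N : (forall n, 0 <= a n) -> (forall n, 0 <= b n) ->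
  \sum_(n < N) cauchy_prod a b n <= (\sum_(n < N) a n) * \sum_(n < N) b n.
Proof.
move=> a0 b0; rewrite sum_cauchy_prod mulr_suml; apply: ler_sum => k _.
by apply: ler_wpM2l => //; apply: ler_sum_ord => //; exact: leq_subr.
Qed.

(** Conversely, the square k, j < N lies in the triangle k + j < 2N. *)
Lemma sum_cauchy_prod_ge a b N : (forall n, 0 <= a n) -> (forall n, 0 <= b n) ->
  (\sum_(n < N) a n) * \sum_(n < N) b n <= \sum_(n < N + N) cauchy_prod a b n.
Proof.
move=> a0 b0; rewrite sum_cauchy_prod mulr_suml.
pose F k := a k * \sum_(j < N + N - k) b j.
apply: (@le_trans _ _ (\sum_(k < N) F k)).
  apply: ler_sum => k _; apply: ler_wpM2l => //; apply: ler_sum_ord => //.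
  by rewrite -addnBA ?leq_addr// ltnW.
apply: (@ler_sum_ord F); last exact: leq_addr.
by move=> k; rewrite mulr_ge0// sumr_ge0.
Qed.

(** Leibniz rule for multiplication by the index, from n = k + (n - k). It later distributes the
    length of a path over its two halves. *)
Lemma cauchy_prod_mulrn a b n :
  n%:R * cauchy_prod a b n =
  cauchy_prod (fun k => k%:R * a k) b n + cauchy_prod a (fun k => k%:R * b k) n.
Proof.
rewrite /cauchy_prod mulr_sumr -big_split /=; apply: eq_bigr => k _.
have kn : (k <= n)%N by rewrite -ltnS.
rewrite -{1}(subnKC kn) natrD mulrDl; congr (_ + _); first by rewrite mulrA.
by rewrite mulrCA.
Qed.

End convolution.

(** * Enumeration of the paths of a given length *)

Section termination_paths.
Variables (Q G : finType) (D : ppda Q G).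
Local Notation config := (Q * seq G)%type.

(** Configurations form an infinite type, so sums over paths run over explicit finite lists.
    Transitions of weight zero are kept, since [step] admits them. *)
Definition succs (c : config) : seq config :=
  if c.2 is Z :: beta then
    [seq (ra.1, (ra.2 : 2.-bseq G) ++ beta) |
      ra <- enum {: Q * 2.-bseq G} & delta D c.1 Z ra.1 ra.2 != None]
  else [::].

Lemma mem_succs c d : (d \in succs c) = step D c d.
Proof.
case: c d => p [|Z beta] [q gam] //; rewrite /succs /step /=.
apply/mapP/existsP => [[[r al]]|[al /andP[pqal /eqP ->]]].
  by rewrite mem_filter /= => /andP[? _] [-> ->]; exists al; apply/andP.
by exists (q, al); rewrite // mem_filter pqal mem_enum.
Qed.

Lemma succs_uniq c : uniq (succs c).
Proof.
case: c => p [|Z beta] //; rewrite map_inj_uniq ?filter_uniq -?enumT ?enum_uniq //.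
by move=> [r al] [r' al'] /= [-> /catIs/val_inj ->].
Qed.

Fixpoint paths n (c : config) : seq (seq config) :=
  if n is n'.+1 then [seq d :: s | d <- succs c, s <- paths n' d] else [:: [::]].

Lemma mem_paths n c s : (s \in paths n c) = path (step D) c s && (size s == n).
Proof.
elim: n c s => [|n IH] c s; first by case: s => [|d s] //=; rewrite andbF.
apply/allpairsPdep/idP => [[d [s' [cd s'n ->]]]|].
  by move: cd s'n; rewrite mem_succs IH /= eqSS => -> /andP[-> ->].
case: s => [|d s]; first by [].
by rewrite /= eqSS => /andP[/andP[cd ds] sn]; exists d, s; rewrite mem_succs IH cd ds.
Qed.

Lemma paths_uniq n c : uniq (paths n c).
Proof.
elim: n c => [|n IH] c //=; apply: allpairs_uniq_dep => //; first exact: succs_uniq.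
by move=> [d s] [d' s'] _ _ /= [-> ->].
Qed.

Lemma step_prob_cat p Z beta r (al : 2.-bseq G) :
  step_prob D (p, Z :: beta) (r, al ++ beta) = weight D p Z r al.
Proof.
rewrite /step_prob /= (big_pred1 al) // => al'.
by rewrite (inj_eq (@catIs _ beta)) eq_sym.
Qed.

End termination_paths.

(** * Termination after exactly n steps *)

Section termination_probabilities.
Variables (R : realType) (Q G : finType) (D : ppda Q G).
Local Notation config := (Q * seq G)%type.
Local Notation w p Z q al := (ratr (weight D p Z q al) : R).

(** Grading by the exact length turns sums over infinitely many paths into series in n, in which the
    length of a path is the factor n. *)
Definition term_prob n (c : config) (q : Q) : R :=
  \sum_(s <- paths D n c | last c s == (q, [::])) ratr (path_prob D c s).

Lemma term_prob0 c q : term_prob 0 c q = (c == (q, [::]))%:R.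
Proof.
by rewrite /term_prob /= big_mkcond big_seq1 /= rmorph1; case: eqP.
Qed.

Lemma term_probS_nil n p q : term_prob n.+1 (p, [::]) q = 0.
Proof. by rewrite /term_prob /= big_nil. Qed.

Lemma term_probS n p Z beta q : term_prob n.+1 (p, Z :: beta) q =
  \sum_(r : Q) \sum_(al : 2.-bseq G) w p Z r al * term_prob n (r, al ++ beta) q.
Proof.
rewrite /term_prob /= big_mkcond big_allpairs_dep /=.
under eq_bigr do rewrite -big_mkcond /=.
rewrite big_map big_filter pair_bigA /= big_enum_cond big_mkcond /=.
apply: eq_bigr => -[r al] _ /=.
under eq_bigr do rewrite step_prob_cat rmorphM.
rewrite -mulr_sumr; case: ifPn => //; rewrite negbK /weight => /eqP -> /=.
by rewrite rmorph0 mul0r.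
Qed.

Lemma weight_ge0 p Z q al : 0 <= w p Z q al.
Proof.
rewrite ler0q /weight; case E : (delta D p Z q al) => [a|] //=.
exact: delta_ge0 E.
Qed.

Lemma weight_sum1 p Z : \sum_(r : Q) \sum_(al : 2.-bseq G) w p Z r al = 1.
Proof.
rewrite -(rmorph1 (@ratr R)) -(delta_sum1 D p Z) rmorph_sum.
by apply: eq_bigr => r _; rewrite rmorph_sum.
Qed.

Lemma term_prob_ge0 n c q : 0 <= term_prob n c q.
Proof.
elim: n c => [|n IH] [p [|Z beta]]; rewrite ?term_prob0 ?term_probS_nil //.
by rewrite term_probS; do 2![apply: sumr_ge0 => ? _]; rewrite mulr_ge0 ?weight_ge0.
Qed.

(** Induction along the first step, whose weights add up to 1. A configuration with empty stack
    contributes only at time 0 and only in its own state. *)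
Lemma sum_term_prob_le1 N c : \sum_(q : Q) \sum_(n < N) term_prob n c q <= 1.
Proof.
elim: N c => [|N IH] [p [|Z beta]].
- by rewrite big1 ?ler01// => q _; rewrite big_ord0.
- by rewrite big1 ?ler01// => q _; rewrite big_ord0.
- under eq_bigr => q _.
    rewrite big_ord_recl big1 ?addr0 ?term_prob0; last first.
      by move=> n _; rewrite term_probS_nil.
    over.
  rewrite (bigD1 p) //= eqxx big1 ?addr0// => q qp.
  by rewrite xpair_eqE eq_sym (negPf qp).
- under eq_bigr => q _.
    rewrite big_ord_recl term_prob0 xpair_eqE andbF add0r.
    under eq_bigr do rewrite term_probS.
    rewrite exchange_big /=.
    under eq_bigr do (rewrite exchange_big /=; under eq_bigr do rewrite -mulr_sumr).
    over.
  rewrite exchange_big /= -(weight_sum1 p Z); apply: ler_sum => r _.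
  rewrite exchange_big /=; apply: ler_sum => al _.
  by rewrite -mulr_sumr ler_piMr ?weight_ge0.
Qed.

(* A path that empties al ++ beta splits uniquely at the moment at which beta
   becomes exposed. *)
Lemma term_prob_cat n p al beta q : term_prob n (p, al ++ beta) q =
  \sum_(t : Q) cauchy_prod (fun k => term_prob k (p, al) t)
                      (fun k => term_prob k (t, beta) q) n.
Proof.
elim: n p al => [|n IH] p [|Z al].
- under eq_bigr do rewrite /cauchy_prod big_ord1 subn0 !term_prob0 !xpair_eqE andbT.
  rewrite (bigD1 p) //= eqxx mul1r big1 ?addr0 ?term_prob0//.
  by move=> t tp; rewrite eq_sym (negPf tp) mul0r.
- rewrite term_prob0 xpair_eqE andbF big1// => t _.
  by rewrite /cauchy_prod big_ord1 term_prob0 xpair_eqE andbF mul0r.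
- rewrite (bigD1 p) //= [X in _ + X]big1 ?addr0 => [|t tp].
    rewrite /cauchy_prod big_ord_recl subn0 term_prob0 eqxx mul1r big1 ?addr0// => k _.
    by rewrite term_probS_nil mul0r.
  rewrite /cauchy_prod big_ord_recl term_prob0 xpair_eqE eq_sym (negPf tp) mul0r add0r.
  by rewrite big1// => k _; rewrite term_probS_nil mul0r.
- rewrite cat_cons term_probS.
  transitivity (\sum_(t : Q) \sum_(r : Q) \sum_(ga : 2.-bseq G) w p Z r ga *
      cauchy_prod (fun k => term_prob k (r, ga ++ al) t)
           (fun k => term_prob k (t, beta) q) n).
    rewrite [RHS]exchange_big /=; apply: eq_bigr => r _.
    rewrite [RHS]exchange_big /=; apply: eq_bigr => ga _.
    by rewrite catA IH -mulr_sumr.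
  apply: eq_bigr => t _.
  rewrite [RHS]/cauchy_prod big_ord_recl term_prob0 xpair_eqE andbF mul0r add0r.
  transitivity (\sum_(k < n.+1) \sum_(r : Q) \sum_(ga : 2.-bseq G) w p Z r ga *
      (term_prob k (r, ga ++ al) t * term_prob (n - k) (t, beta) q)).
    rewrite [RHS]exchange_big /=; apply: eq_bigr => r _.
    by rewrite [RHS]exchange_big /=; apply: eq_bigr => ga _; rewrite -mulr_sumr.
  apply: eq_bigr => k _; rewrite term_probS subSS mulr_suml; apply: eq_bigr => r _.
  by rewrite mulr_suml; apply: eq_bigr => ga _; rewrite mulrA.
Qed.

End termination_probabilities.

(** * The fundamental system on real vectors *)

Section fundamental_system.
Variables (R : realType) (Q G : finType) (D : ppda Q G).
Local Notation I := (Q * G * Q)%type.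
Local Notation w p Z q al := (ratr (weight D p Z q al) : R).
Implicit Types (x y z : I -> R) (i : I).

(** [pop_weight], [lin] and [bil] are the parts c, l and b of f. The form b is not symmetric, so the
    derivative of b(x, x) at r in direction E is b(r, E) + b(E, r). *)
Definition pop_weight i : R :=
  w i.1.1 i.1.2 i.2 (Bseq (isT : (size ([::] : seq G) <= 2)%N)).

Definition lin x i : R := \sum_(r : Q) \sum_(Y : G)
  w i.1.1 i.1.2 r (Bseq (isT : (size [:: Y] <= 2)%N)) * x (r, Y, i.2).

Definition bil x y i : R := \sum_(r : Q) \sum_(Y : G) \sum_(X : G)
  w i.1.1 i.1.2 r (Bseq (isT : (size [:: Y; X] <= 2)%N))
    * \sum_(t : Q) x (r, Y, t) * y (t, X, i.2).

Lemma fppsE x i :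
  fpps D (fun j => (x j)%:E) i = (pop_weight i + lin x i + bil x x i)%:E.
Proof.
case: i => [[p Z] q]; rewrite /fpps /= !EFinD; congr (_ + _ + _)%E.
  by rewrite /lin -sumEFin; apply: eq_bigr => r _ /=; rewrite -sumEFin.
rewrite /bil -sumEFin; apply: eq_bigr => r _ /=; rewrite -sumEFin.
apply: eq_bigr => Y _ /=; rewrite -sumEFin; apply: eq_bigr => X _ /=.
by rewrite [RHS]EFinM -sumEFin.
Qed.

Lemma pop_weight_ge0 i : 0 <= pop_weight i. Proof. exact: weight_ge0. Qed.

Lemma ler_lin x y i : (forall j, x j <= y j) -> lin x i <= lin y i.
Proof.
move=> xy; do 2![apply: ler_sum => ? _].
by rewrite ler_wpM2l ?weight_ge0.
Qed.

Lemma ler_bil x y x' y' i : (forall j, 0 <= x j) -> (forall j, 0 <= y j) ->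
  (forall j, x j <= x' j) -> (forall j, y j <= y' j) -> bil x y i <= bil x' y' i.
Proof.
move=> x0 y0 xx' yy'; do 3![apply: ler_sum => ? _].
rewrite ler_wpM2l ?weight_ge0//; apply: ler_sum => t _.
by rewrite ler_pM.
Qed.

Lemma linD x y i : lin (fun j => x j + y j) i = lin x i + lin y i.
Proof.
rewrite -big_split; apply: eq_bigr => r _; rewrite -big_split.
by apply: eq_bigr => Y _; rewrite mulrDr.
Qed.

Lemma linZ a x i : lin (fun j => a * x j) i = a * lin x i.
Proof.
rewrite mulr_sumr; apply: eq_bigr => r _; rewrite mulr_sumr.
by apply: eq_bigr => Y _; rewrite mulrCA.
Qed.

Lemma bilDl x y z i : bil (fun j => x j + y j) z i = bil x z i + bil y z i.
Proof.
rewrite -big_split; apply: eq_bigr => r _; rewrite -big_split.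
apply: eq_bigr => Y _; rewrite -big_split; apply: eq_bigr => X _ /=.
rewrite -mulrDr -big_split; congr (_ * _); apply: eq_bigr => t _.
by rewrite mulrDl.
Qed.

Lemma bilDr x y z i : bil z (fun j => x j + y j) i = bil z x i + bil z y i.
Proof.
rewrite -big_split; apply: eq_bigr => r _; rewrite -big_split.
apply: eq_bigr => Y _; rewrite -big_split; apply: eq_bigr => X _ /=.
rewrite -mulrDr -big_split; congr (_ * _); apply: eq_bigr => t _.
by rewrite mulrDr.
Qed.

Lemma bilZl a x z i : bil (fun j => a * x j) z i = a * bil x z i.
Proof.
rewrite mulr_sumr; apply: eq_bigr => r _; rewrite mulr_sumr.
apply: eq_bigr => Y _; rewrite mulr_sumr; apply: eq_bigr => X _ /=.
rewrite mulrCA; congr (_ * _); rewrite mulr_sumr; apply: eq_bigr => t _.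
by rewrite mulrA.
Qed.

Lemma bilZr a x z i : bil z (fun j => a * x j) i = a * bil z x i.
Proof.
rewrite mulr_sumr; apply: eq_bigr => r _; rewrite mulr_sumr.
apply: eq_bigr => Y _; rewrite mulr_sumr; apply: eq_bigr => X _ /=.
rewrite mulrCA; congr (_ * _); rewrite mulr_sumr; apply: eq_bigr => t _.
by rewrite mulrCA.
Qed.

Lemma lin_ge0 x i : (forall j, 0 <= x j) -> 0 <= lin x i.
Proof. by move=> x0; do 2![apply: sumr_ge0 => ? _]; rewrite mulr_ge0 ?weight_ge0. Qed.

Lemma bil_ge0 x y i : (forall j, 0 <= x j) -> (forall j, 0 <= y j) -> 0 <= bil x y i.
Proof.
move=> x0 y0; do 3![apply: sumr_ge0 => ? _]; rewrite mulr_ge0 ?weight_ge0//.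
by apply: sumr_ge0 => t _; rewrite mulr_ge0.
Qed.

Lemma lin_sum (a : nat -> I -> R) N i :
  \sum_(n < N) lin (a n) i = lin (fun j => \sum_(n < N) a n j) i.
Proof.
rewrite /lin [LHS]exchange_big; apply: eq_bigr => r _; rewrite [LHS]exchange_big.
by apply: eq_bigr => Y _; rewrite mulr_sumr.
Qed.

(** [bil] with its products replaced by Cauchy products: the n steps are shared between the two
    pushed symbols. *)
Definition bilconv (a b : nat -> I -> R) n i : R :=
  \sum_(r : Q) \sum_(Y : G) \sum_(X : G)
  w i.1.1 i.1.2 r (Bseq (isT : (size [:: Y; X] <= 2)%N))
    * \sum_(t : Q) cauchy_prod (fun k => a k (r, Y, t)) (fun k => b k (t, X, i.2)) n.

Lemma bilconv_sum a b N i : \sum_(n < N) bilconv a b n i =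
  \sum_(r : Q) \sum_(Y : G) \sum_(X : G)
  w i.1.1 i.1.2 r (Bseq (isT : (size [:: Y; X] <= 2)%N)) * \sum_(t : Q)
    \sum_(n < N) cauchy_prod (fun k => a k (r, Y, t)) (fun k => b k (t, X, i.2)) n.
Proof.
rewrite /bilconv [LHS]exchange_big; apply: eq_bigr => r _.
rewrite [LHS]exchange_big; apply: eq_bigr => Y _.
rewrite [LHS]exchange_big; apply: eq_bigr => X _ /=.
by rewrite -mulr_sumr [in RHS]exchange_big.
Qed.

Lemma bilconv_mulrn a b n i : n%:R * bilconv a b n i =
  bilconv (fun k j => k%:R * a k j) b n i + bilconv a (fun k j => k%:R * b k j) n i.
Proof.
rewrite mulr_sumr -big_split; apply: eq_bigr => r _.
rewrite mulr_sumr -big_split; apply: eq_bigr => Y _.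
rewrite mulr_sumr -big_split; apply: eq_bigr => X _ /=.
rewrite mulrCA -mulrDr; congr (_ * _).
by rewrite mulr_sumr -big_split; apply: eq_bigr => t _; rewrite cauchy_prod_mulrn.
Qed.

Section bilconv_bounds.
Variables (a b : nat -> I -> R) (N : nat) (i : I).
Hypotheses (a0 : forall n j, 0 <= a n j) (b0 : forall n j, 0 <= b n j).

Lemma bilconv_sum_le : \sum_(n < N) bilconv a b n i <=
  bil (fun j => \sum_(n < N) a n j) (fun j => \sum_(n < N) b n j) i.
Proof.
rewrite bilconv_sum; do 3![apply: ler_sum => ? _].
rewrite ler_wpM2l ?weight_ge0//; apply: ler_sum => t _; exact: sum_cauchy_prod_le.
Qed.

Lemma bilconv_sum_ge :
  bil (fun j => \sum_(n < N) a n j) (fun j => \sum_(n < N) b n j) i <=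
  \sum_(n < N + N) bilconv a b n i.
Proof.
rewrite bilconv_sum; do 3![apply: ler_sum => ? _].
rewrite ler_wpM2l ?weight_ge0//; apply: ler_sum => t _; exact: sum_cauchy_prod_ge.
Qed.

End bilconv_bounds.

(** * Return probabilities and moments by exact length, and their partial sums *)

Definition ret_term n i : R := term_prob R D n (i.1.1, [:: i.1.2]) i.2.
Definition moment_term n i : R := n%:R * ret_term n i.
Definition ret_psum N i : R := \sum_(n < N) ret_term n i.
Definition moment_psum N i : R := \sum_(n < N) moment_term n i.

Lemma ret_term0 i : ret_term 0 i = 0.
Proof. by rewrite /ret_term term_prob0 xpair_eqE andbF. Qed.

(** Decomposition by the first step. A pop ends the path at once, so it contributes only for n = 0;
    after a push, [term_prob_cat] splits the remaining n steps. *)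
Lemma ret_termS n i : ret_term n.+1 i =
  (n == 0)%:R * pop_weight i + lin (ret_term n) i + bilconv ret_term ret_term n i.
Proof.
case: i => [[p Z] q]; rewrite /ret_term term_probS /=.
under eq_bigr do rewrite sum_2bseq.
rewrite !big_split /=; congr (_ + _ + _).
  rewrite (bigD1 q) //= big1 ?addr0 => [|r rq].
    by case: n => [|n]; rewrite ?term_prob0 ?term_probS_nil ?eqxx mulrC.
  case: n => [|n]; last by rewrite term_probS_nil mulr0.
  by rewrite term_prob0 xpair_eqE (negPf rq) mulr0.
apply: eq_bigr => r _; apply: eq_bigr => Y _; apply: eq_bigr => X _ /=.
by rewrite -term_prob_cat.
Qed.

Lemma ret_term_ge0 n i : 0 <= ret_term n i.
Proof. exact: term_prob_ge0. Qed.

Lemma moment_term_ge0 n i : 0 <= moment_term n i.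
Proof. by rewrite mulr_ge0// ret_term_ge0. Qed.

Lemma ret_psum_ge0 N i : 0 <= ret_psum N i.
Proof. by apply: sumr_ge0 => n _; exact: ret_term_ge0. Qed.

Lemma ret_psum_le1 N i : ret_psum N i <= 1.
Proof.
apply: le_trans (sum_term_prob_le1 R D N (i.1.1, [:: i.1.2])).
rewrite (bigD1 i.2) //= lerDl; apply: sumr_ge0 => q _.
by apply: sumr_ge0 => n _; exact: term_prob_ge0.
Qed.

Lemma ret_psumS N i : ret_psum N.+1 i = (0 < N)%:R * pop_weight i + lin (ret_psum N) i
  + \sum_(n < N) bilconv ret_term ret_term n i.
Proof.
rewrite /ret_psum big_ord_recl ret_term0 add0r.
under eq_bigr do rewrite ret_termS.
rewrite !big_split /= lin_sum -mulr_suml; congr (_ * _ + _ + _).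
by case: N => [|N]; rewrite ?big_ord0// big_ord_recl big1 ?addr0.
Qed.

Lemma ret_psumS_le N i : ret_psum N.+1 i <=
  pop_weight i + lin (ret_psum N) i + bil (ret_psum N) (ret_psum N) i.
Proof.
rewrite ret_psumS !lerD//.
  by rewrite ler_piMl ?pop_weight_ge0//; case: (0 < N)%N; rewrite ?ler01.
exact: bilconv_sum_le ret_term_ge0 ret_term_ge0.
Qed.

Lemma ret_psum_le M N i : (M <= N)%N -> ret_psum M i <= ret_psum N i.
Proof. by apply: (@ler_sum_ord _ (ret_term^~ i)) => n; exact: ret_term_ge0. Qed.

Lemma moment_psum_le M N i : (M <= N)%N -> moment_psum M i <= moment_psum N i.
Proof.
by apply: (@ler_sum_ord _ (moment_term^~ i)) => n; exact: moment_term_ge0.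
Qed.

(** Two subpaths of fewer than N steps and the first step together have fewer than 2N + 1 steps.
    With [ret_psumS_le] this encloses f at the partial sums, so that the limit is a fixed point. *)
Lemma ret_psum_double N i : (0 < N)%N ->
  pop_weight i + lin (ret_psum N) i + bil (ret_psum N) (ret_psum N) i <=
  ret_psum (N + N).+1 i.
Proof.
move=> N0; rewrite ret_psumS addn_gt0 N0 mul1r !lerD//.
  by apply: ler_lin => j; apply: ret_psum_le; exact: leq_addr.
exact: bilconv_sum_ge ret_term_ge0 ret_term_ge0.
Qed.

(** A path of n + 1 steps has weight n + 1 in the moment: the 1 for the first step yields the return
    probability, and the n is distributed by the Leibniz rule. *)
Lemma moment_psum_double N i :
  ret_psum N i + lin (moment_psum N) i
  + bil (ret_psum N) (moment_psum N) i + bil (moment_psum N) (ret_psum N) i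
  <= moment_psum (N + N).+1 i.
Proof.
have -> : moment_psum (N + N).+1 i = ret_psum (N + N).+1 i
    + lin (moment_psum (N + N)) i
    + (\sum_(n < N + N) bilconv ret_term moment_term n i
       + \sum_(n < N + N) bilconv moment_term ret_term n i).
  rewrite -(lin_sum moment_term) /moment_psum /ret_psum !big_ord_recl.
  rewrite /moment_term ret_term0 mul0r !add0r -!big_split; apply: eq_bigr => n _ /=.
  rewrite /bump leq0n add1n -natr1 mulrDl mul1r [LHS]addrC -!addrA; congr (_ + _).
  rewrite ret_termS !mulrDr -linZ bilconv_mulrn mulrA -natrM.
  (* The pop term vanishes: it occurs only for n = 0 and carries the factor n. *)
  have -> : (n * (n == 0 :> nat))%N = 0%N by case: (nat_of_ord n) => [|k]; rewrite ?muln0.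
  by rewrite mul0r add0r [X in _ + X = _]addrC.
rewrite -!addrA lerD//; last rewrite lerD//; last rewrite lerD//.
- by apply: ret_psum_le; rewrite -addnS leq_addr.
- by apply: ler_lin => j; apply: moment_psum_le; exact: leq_addr.
- exact: bilconv_sum_ge ret_term_ge0 moment_term_ge0.
- exact: bilconv_sum_ge moment_term_ge0 ret_term_ge0.
Qed.

End fundamental_system.

(** * Passage to the limit: return probabilities as least fixed point *)

Section limits.
Import numFieldNormedType.Exports.
Local Open Scope classical_set_scope.

Lemma cvg_nneseries (R : realType) (u : nat -> R) (l : R) :
  (forall n, 0 <= u n) -> (\sum_(0 <= n <oo) (u n)%:E = l%:E)%E ->
  (fun N => \sum_(n < N) u n) @ \oo --> l.
Proof.
move=> u0 ul.
have : (fun N => \sum_(0 <= n < N) (u n)%:E)%E @ \oo --> l%:E.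
  by rewrite -ul; apply: is_cvg_nneseries => n _ _; rewrite lee_fin.
move=> /fine_cvg; apply: cvg_trans; apply: near_eq_cvg; near=> N.
by rewrite /= sumEFin big_mkord.
Unshelve. all: by end_near. Qed.

Lemma cvg_sumr (R : realType) (I : Type) (r : seq I) (f : I -> nat -> R) (l : I -> R) :
  (forall i, f i @ \oo --> l i) ->
  (fun N => \sum_(i <- r) f i N) @ \oo --> \sum_(i <- r) l i.
Proof. by move=> fl; apply: cvg_big => [|i _]; [exact: add_continuous|exact: fl]. Qed.

Section return_probabilities.
Variables (R : realType) (Q G : finType) (D : ppda Q G).
Local Notation I := (Q * G * Q)%type.
Local Notation config := (Q * seq G)%type.
Implicit Types (x y : I -> R) (i : I).

Lemma path_prob_ge0 c s : 0 <= path_prob D c s.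
Proof.
elim: s c => [|d s IH] c //=; rewrite mulr_ge0// /step_prob.
case: c => p [|Z beta] //=; apply: sumr_ge0 => al _.
by rewrite -(ler0q R) weight_ge0.
Qed.

(** The terminating paths are the disjoint union over n of the finite sets of those of length n, and
    nonnegative terms may be regrouped. *)
Lemma esum_term_paths p Z q (g : seq config -> \bar R) :
  (forall s, (0 <= g s)%E) ->
  (\esum_(s in term_paths D p Z q) g s = \sum_(0 <= n <oo)
    \sum_(s <- paths D n (p, [:: Z]) | last (p, [:: Z]) s == (q, [::])) g s)%E.
Proof.
move=> g0; pose r n := [seq s <- paths D n (p, [:: Z]) | last (p, [:: Z]) s == (q, [::])].
have -> : term_paths D p Z q = \bigcup_n [set` r n].
  apply/seteqP; split=> [s [ps /eqP ls]|s [n _]].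
    by exists (size s); rewrite //= mem_filter ls mem_paths ps eqxx.
  by rewrite /= mem_filter mem_paths => /andP[/eqP ? /andP[? _]].
rewrite nneseries_sum_bigcup//; last first.
  move=> n m _ _ [s []] /=; rewrite !mem_filter !mem_paths.
  by move=> /and3P[_ _ /eqP <-] /and3P[_ _ /eqP].
apply: eq_eseriesr => n _; have fin_r : finite_set [set` r n] by exact: finite_seq.
rewrite esum_fset//.
by rewrite -fsbig_seq ?filter_uniq ?paths_uniq// big_filter.
Qed.

Lemma ret_probE i :
  ret_prob R D i = (\sum_(0 <= n <oo) (ret_term R D n i)%:E)%E.
Proof.
rewrite /ret_prob esum_term_paths => [|s]; last by rewrite lee_fin ler0q path_prob_ge0.
by apply: eq_eseriesr => n _; rewrite sumEFin.
Qed.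

Lemma term_momentE i :
  term_moment R D i = (\sum_(0 <= n <oo) (moment_term R D n i)%:E)%E.
Proof.
rewrite /term_moment esum_term_paths => [|s]; last first.
  by rewrite lee_fin mulr_ge0// ler0q path_prob_ge0.
apply: eq_eseriesr => n _; rewrite sumEFin /moment_term mulr_sumr; congr EFin.
rewrite big_seq_cond [RHS]big_seq_cond; apply: eq_bigr => s /andP[].
by rewrite mem_paths mulrC => /andP[_ /eqP ->].
Qed.

Lemma cvg_lin (u : nat -> I -> R) x i : (forall j, u ^~ j @ \oo --> x j) ->
  (fun N => lin D (u N) i) @ \oo --> lin D x i.
Proof.
move=> ux; apply: cvg_sumr => r; apply: cvg_sumr => Y.
by apply: cvgM; [exact: cvg_cst|exact: ux].
Qed.

Lemma cvg_bil (u v : nat -> I -> R) x y i :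
  (forall j, u ^~ j @ \oo --> x j) -> (forall j, v ^~ j @ \oo --> y j) ->
  (fun N => bil D (u N) (v N) i) @ \oo --> bil D x y i.
Proof.
move=> ux vy; apply: cvg_sumr => r; apply: cvg_sumr => Y; apply: cvg_sumr => X.
apply: cvgM; [exact: cvg_cst|apply: cvg_sumr => t].
by apply: cvgM; [exact: ux|exact: vy].
Qed.

Definition ret i : R := fine (ret_prob R D i).
(** [fine] sends +oo to 0, so this value is faithful only for finite moments; [EFin_moment] derives
    this from [cPAST]. *)
Definition moment i : R := fine (term_moment R D i).

Lemma ret_prob_ge0 i : (0 <= ret_prob R D i)%E.
Proof. by apply: esum_ge0 => s _; rewrite lee_fin ler0q path_prob_ge0. Qed.

Lemma ret_prob_le1 i : (ret_prob R D i <= 1)%E.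
Proof.
rewrite ret_probE; apply: lime_le.
  by apply: is_cvg_nneseries => n _ _; rewrite lee_fin ret_term_ge0.
by near=> N; rewrite sumEFin big_mkord lee_fin ret_psum_le1.
Unshelve. all: by end_near. Qed.

Lemma EFin_ret i : (ret i)%:E = ret_prob R D i.
Proof.
by rewrite fineK// ge0_fin_numE ?ret_prob_ge0// (le_lt_trans (ret_prob_le1 i)) ?ltry.
Qed.

Lemma ret_ge0 i : 0 <= ret i. Proof. exact/fine_ge0/ret_prob_ge0. Qed.

Lemma ret_le1 i : ret i <= 1.
Proof. by rewrite -lee_fin EFin_ret ret_prob_le1. Qed.

Lemma cvg_ret_psum i : (ret_psum R D) ^~ i @ \oo --> ret i.
Proof.
apply: (@cvg_nneseries _ (ret_term R D ^~ i)); first by move=> n; exact: ret_term_ge0.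
by rewrite -ret_probE EFin_ret.
Qed.

Lemma ret_psum_le_ret N i : ret_psum R D N i <= ret i.
Proof.
rewrite -lee_fin EFin_ret ret_probE -sumEFin.
have := @nneseries_lim_ge R (fun n => (ret_term R D n i)%:E) xpredT 0 N.
by rewrite big_mkord; apply=> n _ _; rewrite lee_fin ret_term_ge0.
Qed.

Lemma ret_fixed i : pop_weight R D i + lin D ret i + bil D ret ret i = ret i.
Proof.
apply/eqP; rewrite eq_le; apply/andP; split.
- apply: (@ler_cvg_to _ \oo _ _ (fun N => pop_weight R D i + lin D (ret_psum R D N) i
      + bil D (ret_psum R D N) (ret_psum R D N) i) (fun=> ret i)).
  + apply: cvgD; last exact: cvg_bil cvg_ret_psum cvg_ret_psum.
    by apply: cvgD; [exact: cvg_cst|exact: cvg_lin cvg_ret_psum].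
  + exact: cvg_cst.
  + near=> N; apply: le_trans (ret_psum_le_ret (N + N).+1 i).
    by apply: ret_psum_double; near: N; exact: nbhs_infty_gt.
- apply: (@ler_cvg_to _ \oo _ _ (fun N => ret_psum R D N i)
    (fun=> pop_weight R D i + lin D ret i + bil D ret ret i)).
  + exact: cvg_ret_psum.
  + exact: cvg_cst.
  + near=> N; apply: (le_trans (ret_psum_le _ _ i (leqnSn N))).
    apply: le_trans (ret_psumS_le _ _ _ _) _.
    rewrite !lerD//; first by apply: ler_lin => j; exact: ret_psum_le_ret.
    by apply: ler_bil => j; rewrite ?ret_psum_ge0 ?ret_psum_le_ret.
Unshelve. all: by end_near. Qed.

(** The vector [ret] is a fixed point, hence an upper bound. Conversely, induction with
    [ret_psumS_le] keeps all partial sums below the least fixed point, and so their limit. *)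
Lemma lfp_fpps i : lfp (fpps (R := R) D) i = (ret i)%:E.
Proof.
have [l0 lfix lmin] := fpps_lfp R D.
have l_le j : (lfp (fpps (R := R) D) j <= (ret j)%:E)%E.
  apply: (lmin (fun j => (ret j)%:E)) => k; first by rewrite lee_fin ret_ge0.
  by rewrite fppsE ret_fixed.
(* Being below [ret], the least fixed point is finite and can be treated as a real vector. *)
pose x j := fine (lfp (fpps (R := R) D) j).
have xE j : lfp (fpps (R := R) D) j = (x j)%:E.
  by rewrite fineK// ge0_fin_numE// (le_lt_trans (l_le j)) ?ltry.
have xfix j : x j = pop_weight R D j + lin D x j + bil D x x j.
  by apply: EFin_inj; rewrite -fppsE -xE -lfix; congr fpps; apply/funext => k.
apply/eqP; rewrite eq_le l_le /= xE lee_fin.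
have psum_le N j : ret_psum R D N j <= x j.
  elim: N j => [|N IH] j; first by rewrite /ret_psum big_ord0 -lee_fin -xE.
  apply: le_trans (ret_psumS_le _ _ _ _) _; rewrite xfix !lerD//.
    exact: ler_lin.
  by apply: ler_bil => // k; exact: ret_psum_ge0.
apply: (@ler_cvg_to _ \oo _ _ (fun N => ret_psum R D N i) (fun=> x i)).
- exact: cvg_ret_psum.
- exact: cvg_cst.
- by near=> N; exact: psum_le.
Unshelve. all: by end_near. Qed.

(** * Termination moments under [cPAST] *)

Hypothesis past : cPAST R D.

Lemma term_moment_ge0 i : (0 <= term_moment R D i)%E.
Proof. by apply: esum_ge0 => s _; rewrite lee_fin mulr_ge0 ?ler0q ?path_prob_ge0. Qed.

(** All terms of the return series are nonnegative, so a zero sum makes each of them zero. This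
    settles the indices that [cPAST] does not constrain. *)
Lemma term_moment_eq0 i : ret i = 0 -> term_moment R D i = 0%E.
Proof.
move=> ri; rewrite term_momentE eseries0// => n _ _; congr EFin.
rewrite /moment_term; suff -> : ret_term R D n i = 0 by rewrite mulr0.
apply/eqP; rewrite eq_le ret_term_ge0 andbT -ri.
apply: le_trans (ret_psum_le_ret n.+1 i).
by rewrite /ret_psum big_ord_recr /= lerDr ret_psum_ge0.
Qed.

Lemma EFin_moment i : (moment i)%:E = term_moment R D i.
Proof.
have := ret_ge0 i; rewrite le_eqVlt => /predU1P[/esym r0|r0].
  by rewrite /moment term_moment_eq0.
have := past; move=> /(_ i); rewrite -EFin_ret lte_fin => /(_ r0).
rewrite /moment; have := term_moment_ge0 i.
case: (term_moment R D i) => //= _; rewrite inver gt_eqF//.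
by rewrite gt0_mulye ?ltxx// lte_fin invr_gt0.
Qed.

Lemma moment_ge0 i : 0 <= moment i.
Proof. exact/fine_ge0/term_moment_ge0. Qed.

Lemma cvg_moment_psum i : (moment_psum R D) ^~ i @ \oo --> moment i.
Proof.
apply: (@cvg_nneseries _ (moment_term R D ^~ i)); first by move=> n; exact: moment_term_ge0.
by rewrite -term_momentE EFin_moment.
Qed.

Lemma moment_psum_le_moment N i : moment_psum R D N i <= moment i.
Proof.
rewrite -lee_fin EFin_moment term_momentE -sumEFin.
have := @nneseries_lim_ge R (fun n => (moment_term R D n i)%:E) xpredT 0 N.
by rewrite big_mkord; apply=> n _ _; rewrite lee_fin moment_term_ge0.
Qed.

(** The inequality r + f'(r)E <= E, as the limit of [moment_psum_double]. *)
Lemma moment_ineq i :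
  ret i + lin D moment i + bil D ret moment i + bil D moment ret i <= moment i.
Proof.
apply: (@ler_cvg_to _ \oo _ _ (fun N => ret_psum R D N i + lin D (moment_psum R D N) i
    + bil D (ret_psum R D N) (moment_psum R D N) i
    + bil D (moment_psum R D N) (ret_psum R D N) i) (fun=> moment i)).
- apply: cvgD; last exact: cvg_bil cvg_moment_psum cvg_ret_psum.
  apply: cvgD; last exact: cvg_bil cvg_ret_psum cvg_moment_psum.
  by apply: cvgD; [exact: cvg_ret_psum|exact: cvg_lin cvg_moment_psum].
- exact: cvg_cst.
- near=> N; apply: le_trans (moment_psum_le_moment (N + N).+1 i).
  exact: moment_psum_double.
Unshelve. all: by end_near. Qed.

End return_probabilities.

End limits.

(** * A box of inductive points above the return probabilities *)

Section inductive_bound.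
Variables (R : realType) (Q G : finType) (D : ppda Q G).
Hypothesis past : cPAST R D.
Local Notation I := (Q * G * Q)%type.
Local Notation ret := (ret R D).
Local Notation moment := (moment R D).

Lemma ret_le_moment i : ret i <= moment i.
Proof.
have := moment_ineq past i.
have := @lin_ge0 R Q G D moment i (moment_ge0 R D).
have := @bil_ge0 R Q G D ret moment i (ret_ge0 R D) (moment_ge0 R D).
have := @bil_ge0 R Q G D moment ret i (moment_ge0 R D) (ret_ge0 R D).
lra.
Qed.

Lemma cond_runtimeE i : 0 < ret i ->
  (term_moment R D i / ret_prob R D i)%E = (moment i / ret i)%:E.
Proof. by move=> r0; rewrite -(EFin_moment past) -EFin_ret inver gt_eqF. Qed.

Lemma max_cond_runtimeP i0 : 0 < ret i0 ->
  1 <= fine (max_cond_runtime R D)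
  /\ forall i, moment i <= fine (max_cond_runtime R D) * ret i.
Proof.
move=> r0; set C := fine _.
have CE : max_cond_runtime R D = C%:E.
  rewrite fineK// ge0_fin_numE; last by apply: bigmax_ge_id.
  apply: bigmax_lt => [|i ri]; first exact: ltry.
  by rewrite cond_runtimeE ?ltry// -lte_fin EFin_ret.
have leC i : moment i <= C * ret i.
  have := ret_ge0 R D i; rewrite le_eqVlt => /predU1P[/esym ri|ri].
    suff -> : moment i = 0 by rewrite ri mulr0.
    by apply: EFin_inj; rewrite EFin_moment// term_moment_eq0.
  rewrite -ler_pdivrMr// -lee_fin -cond_runtimeE// -CE.
  by apply: le_bigmax_cond; rewrite -EFin_ret lte_fin.
split=> //; rewrite -(ler_pM2r r0) mul1r.
exact: le_trans (ret_le_moment i0) (leC i0).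
Qed.

Lemma min_ret_probP i0 : 0 < ret i0 ->
  [/\ 0 < fine (min_ret_prob R D), fine (min_ret_prob R D) <= 1
    & forall i, 0 < ret i -> fine (min_ret_prob R D) <= ret i].
Proof.
move=> r0; set m := fine _.
have min_le i : 0 < ret i -> (min_ret_prob R D <= (ret i)%:E)%E.
  by move=> ri; rewrite EFin_ret; apply: bigmin_le_cond; rewrite -EFin_ret lte_fin.
have min_gt0 : (0 < min_ret_prob R D)%E by apply: lt_bigmin => //; exact: ltry.
have mE : min_ret_prob R D = m%:E.
  by rewrite fineK// ge0_fin_numE ?(ltW min_gt0)// (le_lt_trans (min_le _ r0)) ?ltry.
have m_le i : 0 < ret i -> m <= ret i by move=> /min_le; rewrite mE lee_fin.
split=> //; first by rewrite -lte_fin -mE.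
exact: le_trans (m_le _ r0) (ret_le1 R D i0).
Qed.

(** The term (d / 8) r is the rounding tolerance. A vector u that also satisfies r + d E <= u then
    has f(u) <= r + d E <= u. *)
Lemma inductive_neighbourhood (C d : R) (u : I -> R) : 1 <= C ->
  (forall i, moment i <= C * ret i) -> 0 < d -> d * C ^+ 2 <= 1 / 2 ->
  (forall i, 0 <= u i <= (1 + d / 8) * ret i + d * moment i) ->
  forall i, pop_weight R D i + lin D u i + bil D u u i <= ret i + d * moment i.
Proof.
move=> C1 leC d0 dC u_itv i.
pose y j := (1 + d / 8) * ret j + d * moment j.
have u0 j : 0 <= u j by have /andP[] := u_itv j.
have uy j : u j <= y j by have /andP[] := u_itv j.
have r_ge0 := ret_ge0 R D; have e_ge0 := moment_ge0 R D.
have Cr_ge0 j : 0 <= C * ret j by rewrite mulr_ge0// (le_trans ler01).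
(* By monotonicity only the upper corner y of the box has to be treated; f(y) is then expanded. *)
apply: (@le_trans _ _ (pop_weight R D i + lin D y i + bil D y y i)).
  by rewrite !lerD// ?ler_lin ?ler_bil.
rewrite /y linD !linZ bilDl !bilDr !bilZl !bilZr.
have fr := ret_fixed R D i; have fe := moment_ineq past i.
have c0 := @pop_weight_ge0 R Q G D i.
have a0 := @lin_ge0 R Q G D ret i r_ge0.
have p0 := @bil_ge0 R Q G D ret ret i r_ge0 r_ge0.
have q1 : bil D ret moment i <= C * bil D ret ret i by rewrite -bilZr; apply: ler_bil.
have q2 : bil D moment ret i <= C * bil D ret ret i by rewrite -bilZl; apply: ler_bil.
have s1 : bil D moment moment i <= C * (C * bil D ret ret i).
  by rewrite -bilZr -bilZl; apply: ler_bil.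
move: (bil D ret ret i) (bil D ret moment i) (bil D moment ret i)
  (bil D moment moment i) (lin D ret i) (lin D moment i) (pop_weight R D i)
  fr fe c0 a0 p0 q1 q2 s1.
move: (ret i) (moment i) => r e p q q' s a b c fr fe c0 a0 p0 q1 q2 s1.
have d1 : d <= 1 / 2.
  by apply: le_trans dC; rewrite ler_peMr ?(ltW d0)// expr_ge1// (le_trans ler01).
have dC1 : d * C <= 1 / 2.
  apply: le_trans dC; rewrite ler_wpM2l ?(ltW d0)// ler_eXnr//.
(* By c + a + p = r, f(y) is r + d (b + q + q') + (d / 8)(a + 2 p) + (d^2 / 64) p + (d^2 / 8)(q +
   q') + d^2 s. The first increment is at most d e - d r by [t1]; by [t2] to [t5] the others add at
   most (1/4 + 1/128 + 1/8 + 1/2) d r, which is below d r. *)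
have t1 : d * (b + q + q') <= d * (e - r) by rewrite ler_pM2l//; lra.
have t2 : d * (a + 2 * p) <= d * (2 * r) by rewrite ler_pM2l//; lra.
have t3 : d * d * p <= d * (1 / 2) * r.
  by rewrite ler_pM ?mulr_ge0 ?(ltW d0) ?ler_pM2l//; lra.
have t4 : d * d * (q + q') <= d * r.
  apply: (@le_trans _ _ (d * ((d * C) * (2 * p)))).
    by rewrite -!mulrA ler_pM2l// ler_pM2l//; lra.
  rewrite ler_pM2l//; apply: (@le_trans _ _ (1 / 2 * (2 * p))); last by lra.
  by rewrite ler_wpM2r//; lra.
have t5 : d * d * s <= d * (r / 2).
  rewrite -mulrA ler_pM2l//; apply: (@le_trans _ _ ((d * C ^+ 2) * p)).
    by rewrite expr2 -!mulrA ler_pM2l.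
  apply: (@le_trans _ _ (1 / 2 * p)); last by lra.
  by rewrite ler_wpM2r.
have dr : 0 <= d * r by rewrite mulr_ge0 ?(ltW d0)//; lra.
lra.
Qed.

End inductive_bound.

(** * Bit sizes, dyadic precision and the choice of parameters *)

Lemma bitsize_pow2_le (a : int) k : 0 <= a -> a <= (2 ^ k)%N%:Z -> (bitsize a <= k + 2)%N.
Proof.
case: a => // n _; rewrite lez_nat => nk; rewrite /bitsize absz_nat addn1 addn2 !ltnS.
by rewrite -(@trunc_expnK 2 k)// leq_trunc_log.
Qed.

Lemma expR_half_le2 (R : realType) : expR (1 / 2) <= 2 :> R.
Proof.
rewrite -[_ / _]opprK expRN -[leRHS]invrK lef_pV2 ?posrE ?expR_gt0 ?invr_gt0//.
by apply: le_trans (expR_ge1Dx _); lra.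
Qed.

(** As exp(1/2) <= 2, the exponent 2 ln x suffices in base 2: x = exp(1/2)^(2 ln x). Rounding it up
    to an integer costs at most 1. *)
Lemma dyadic_precision (R : realType) (x : R) : 1 <= x ->
  exists k : nat, x <= 2 ^+ k /\ k%:R <= 2 * ln x + 1.
Proof.
move=> x1; have x0 : 0 < x by apply: lt_le_trans x1.
have l0 : 0 <= 2 * ln x by rewrite mulr_ge0// ln_ge0.
exists (Num.truncn (2 * ln x)).+1.
have /andP[le_l l_lt] := truncn_itv l0.
split; last by rewrite -natr1 lerD2r.
apply: (@le_trans _ _ (expR ((Num.truncn (2 * ln x)).+1%:R * (1 / 2)))).
  by rewrite -{1}(lnK x0) ler_expR; lra.
by rewrite expRM_natl lerXn2r ?nnegrE ?expR_ge0 ?expR_half_le2.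
Qed.

(* K is the constant of the O(..): it is independent of the pPDA and of eps.
   The summand 1 is needed because all logarithms may vanish, and ln (1/eps) is
   truncated at 0 because eps > 1 is allowed. *)
Theorem theorem9 (R : realType) :
  exists K : nat,
    forall (Q G : finType) (D : ppda Q G),
      cPAST R D ->
      let C := fine (max_cond_runtime R D) in
      let m := fine (min_ret_prob R D) in
      let f := fpps (R := R) D in
      forall eps : R, 0 < eps ->
        exists u : Q * G * Q -> rat,
          let uE := fun i => (ratr (u i) : R)%:E in
          [/\ forall i, 0 <= u i,
              forall i, (f uE i <= uE i)%E,
              (norm_inf (fun i => lfp f i - uE i) <= eps%:E)%E
            & forall i,
                encodable_in
                  (K%:R * (1 + ln C + ln (m^-1) + ln #|Q|%:R + ln #|G|%:R
                           + Num.max 0 (ln (eps^-1))))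
                  (u i)].
Proof.
(* The encoding takes at most 2k + 5 bits, where k <= 2 ln x + 1 and ln x <= 8 + 2 ln C + ln (1/m) +
   L. This gives 39 + 8 ln C + 4 ln (1/m) + 4 L. *)
exists 40%N => Q G D past C m f eps eps0.
set L := Num.max 0 _.
have lnQ : 0 <= ln #|Q|%:R :> R.
  by case: #|Q| => [|n]; [rewrite ln0|rewrite ln_ge0// ler1n].
have lnG : 0 <= ln #|G|%:R :> R.
  by case: #|G| => [|n]; [rewrite ln0|rewrite ln_ge0// ler1n].
have L0 : 0 <= L by rewrite le_max lexx.
(* If all return probabilities vanish, C and m are both 0 by default, their logarithmic terms are 0,
   and u = 0 is the least fixed point itself. *)
have [[i0 r0]|noret] := pselect (exists i, 0 < ret R D i); last first.
  have r0 i : ret R D i = 0.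
    apply/eqP; rewrite eq_le ret_ge0 andbT leNgt; apply/negP => ri.
    by apply: noret; exists i.
  have lnC : ln C = 0.
    rewrite ln0// /C /max_cond_runtime big_pred0// => i.
    by rewrite -EFin_ret r0 ltxx.
  have lnm : ln m^-1 = 0.
    rewrite ln0// /m /min_ret_prob big_pred0 ?invr0// => i.
    by rewrite -EFin_ret r0 ltxx.
  exists (fun=> 0); split=> [//|i||i].
  - have E : (fun j : Q * G * Q => (ratr 0 : R)%:E) = (fun j => (ret R D j)%:E).
      by apply/funext => j; rewrite r0 rmorph0.
    by rewrite /f E fppsE ret_fixed r0 rmorph0.
  - apply: bigmax_le => [|j _]; first by rewrite lee_fin ltW.
    by rewrite lfp_fpps r0 rmorph0 sube0 abse0 lee_fin ltW.
  - exists 0, 1; split=> [||]; [by []|by rewrite mul0r|].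
    rewrite lnC lnm /bitsize /= trunc_log0 trunc_log1; lra.
have [C1 leC] := max_cond_runtimeP past r0; rewrite -/C in C1 leC.
have [m0 m1 lem] := min_ret_probP r0; rewrite -/m in m0 m1 lem.
have C0 : 0 < C by apply: lt_le_trans C1.
have lnC : 0 <= ln C by rewrite ln_ge0.
have lnm : 0 <= ln m^-1 by rewrite ln_ge0// invf_ge1.
(* Truncating eps at 1 keeps d small for large eps and makes ln (1/e1) equal to L. *)
pose e1 := Num.min 1 eps.
have e1_gt0 : 0 < e1 by rewrite lt_min ltr01.
have e1_le1 : e1 <= 1 by rewrite ge_min lexx.
have e1_le : e1 <= eps by rewrite ge_min lexx orbT.
have ln_e1 : ln e1^-1 = L.
  rewrite /L /e1; case: (leP 1 eps) => [h|h].
    by rewrite invr1 ln1 max_l// -ln1 ler_ln ?posrE ?invr_gt0// invf_le1.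
  by rewrite max_r// ln_ge0// invf_ge1// ltW.
(* Chosen so that d C^2 = e1 / 2. This meets the condition d C^2 <= 1/2 and, as C >= 1, bounds d E
   by e1 / 2. *)
pose d := e1 / (2 * C ^+ 2).
have d0 : 0 < d by rewrite divr_gt0// mulr_gt0// exprn_gt0.
have dC2 : d * C ^+ 2 <= 1 / 2.
  have -> : d * C ^+ 2 = e1 / 2 by rewrite /d; field; rewrite gt_eqF.
  by lra.
have dC : d * C <= e1 / 2.
  apply: (@le_trans _ _ (d * C ^+ 2)); first by rewrite ler_pM2l// ler_eXnr.
  by rewrite /d le_eqVlt; apply/orP; left; apply/eqP; field; rewrite gt_eqF.
(* The inverse of the least tolerance d m / 8 on the support; k is chosen with 2^-k <= 1 / x. *)
pose x := 16 * C ^+ 2 * m^-1 * e1^-1.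
have xE : x = 8 / (m * d) by rewrite /x /d; field; rewrite !gt_eqF.
have x1 : 1 <= x.
  rewrite /x -[leLHS](mulr1 1) ler_pM//; last by rewrite invf_ge1.
  rewrite -[leLHS](mulr1 1) ler_pM//; last by rewrite invf_ge1.
  have : 1 <= C ^+ 2 by rewrite expr_ge1// ltW.
  by lra.
have [k [xk kx]] := dyadic_precision x1.
have lnx : ln x <= 8 + 2 * ln C + ln m^-1 + L.
  rewrite /x !lnM ?posrE ?mulr_gt0 ?exprn_gt0 ?invr_gt0// ln_e1.
  have -> : ln 16 = 4 * ln 2 :> R.
    rewrite (_ : 16 = 2 ^+ 4); last by rewrite -natrX.
    by rewrite lnXn// mulr_natl.
  have : ln 2 < 2 :> R by rewrite ln_sublinear.
  by lra.
have p0 : 0 < 2 ^+ k :> R by rewrite exprn_gt0.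
pose y i := ret R D i + d * moment R D i.
have y0 i : 0 <= y i by rewrite addr_ge0 ?ret_ge0// mulr_ge0 ?moment_ge0// ltW.
have e_le i : d * moment R D i <= d * C.
  rewrite ler_pM2l//; apply: le_trans (leC i) _.
  by rewrite -[leRHS]mulr1 ler_pM2l// ret_le1.
(* Rounding upwards keeps u above y = r + d E. *)
pose a i := Num.ceil (y i * 2 ^+ k).
pose u i : rat := (a i)%:~R / (2 ^ k)%N%:Z%:~R.
have a0 i : 0 <= a i by rewrite ceil_ge0 (@lt_le_trans _ _ 0)// mulr_ge0// ltW.
have uE i : ratr (u i) = (a i)%:~R / 2 ^+ k :> R.
  by rewrite /u fmorph_div /= !rmorph_int -pmulrn natrX.
have yu i : y i <= ratr (u i).
  by rewrite uE ler_pdivlMr// ceil_ge.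
have uy i : ratr (u i) <= y i + (2 ^+ k)^-1.
  rewrite uE ler_pdivrMr// mulrDl mulVf ?gt_eqF// -lerBlDr.
  by have := ceilB1_lt (y i * 2 ^+ k); rewrite intrB => /ltW.
have prec : (2 ^+ k)^-1 <= d / 8 * m.
  have -> : d / 8 * m = x^-1 by rewrite xE; field; rewrite !gt_eqF.
  by rewrite lef_pV2 ?posrE// (lt_le_trans ltr01).
have u_le i : ratr (u i) <= (1 + d / 8) * ret R D i + d * moment R D i.
  (* Off the support y = 0 is represented exactly; on it the error 2^-k is at most (d / 8) m <= (d /
     8) r. *)
  have := ret_ge0 R D i; rewrite le_eqVlt => /predU1P[/esym ri|ri].
    have mi : moment R D i = 0.
      by apply/eqP; rewrite eq_le moment_ge0 andbT -(mulr0 C) -ri leC.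
    by rewrite ri mi uE /a /y ri mi !mulr0 addr0 mul0r ceil0 mul0r.
  apply: le_trans (uy i) _; rewrite /y mulrDl mul1r addrAC !lerD2r lerD2l.
  by apply: le_trans prec _; rewrite ler_pM2l ?lem// divr_gt0.
have u_ge0 i : 0 <= u i by rewrite divr_ge0 // ler0z.
exists u; split=> [//|i||i].
- rewrite /f fppsE lee_fin; apply: le_trans (yu i).
  apply: (inductive_neighbourhood past C1 leC d0 dC2) => j.
  by rewrite u_le ler0q u_ge0.
- apply: bigmax_le => [|i _]; first by rewrite lee_fin ltW.
  rewrite lfp_fpps -EFinB abse_EFin lee_fin distrC ger0_norm; last first.
    rewrite subr_ge0; apply: le_trans (yu i).
    by rewrite lerDl mulr_ge0 ?moment_ge0// ltW.
  have r1 := ret_le1 R D i.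
  (* The distance is at most d / 8 + d C <= (9 / 8) d C <= (9 / 16) e1. *)
  have r_le : d / 8 * ret R D i <= d / 8 by rewrite -[leRHS]mulr1 ler_pM2l// divr_gt0.
  have d_le : d <= d * C by rewrite -[leLHS]mulr1 ler_pM2l.
  by have := u_le i; have := e_le i; lra.
- exists (a i), (2 ^ k)%N%:Z; split=> //.
    by rewrite eqz_nat expn_eq0.
  (* Here y <= 1 + d C <= 2, which costs one bit beyond the k bits of precision. *)
  have a_le : a i <= (2 ^ k.+1)%N%:Z.
    rewrite ceil_le_int -pmulrn natrX exprSr -[leRHS]mulrC ler_pM2r//.
    by have := e_le i; have := ret_le1 R D i; rewrite /y; lra.
  have b1 := bitsize_pow2_le (a0 i) a_le.
  have b2 : (bitsize (2 ^ k)%N%:Z <= k + 2)%N by apply: bitsize_pow2_le.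
  apply: (@le_trans _ _ (2 * k%:R + 5)).
    rewrite -natrM -natrD ler_nat (leq_trans (leq_add b1 b2))//.
    by clear; lia.
  lra.
Qed.
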